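(* Let $(X_t)_{t\ge0}$ be the ergodic diffusion described in the context, let $\nu\ll\mu$ be a probability measure with $d\nu/d\mu\in L^2(\mu)$, put $N_\nu=\|d\nu/d\mu\|_{L^2(\mu)}$, and let $\overline{A}_t\in\{\overline{\rho}_t(V),\overline{J}_t(U)\}$. Let $\tilde\sigma_A^2>0$ and $c_A\ge0$ be sub-gamma parameters for which, for all $t>0$ and $a>0$, $$\mathbb{P}^\nu\left(\left|\overline{A}_t-\mathbb{E}^\mu[\overline{A}_t]\right|\ge a\right)\le2N_\nu\exp\left[-t\,\frac{\tilde\sigma_A^2}{c_A^2}\,h\left(\frac{c_Aa}{\tilde\sigma_A^2}\right)\right],\qquad h(u)=1+u-\sqrt{1+2u}.$$ For $\alpha\in(0,1)$ and $t>0$ let $r_A(\alpha,t)=\sqrt{\frac{2\tilde\sigma_A^2}{t}\log\frac{2N_\nu}{\alpha}}+\frac{c_A}{t}\log\frac{2N_\nu}{\alpha}$. Fix a tolerance $\varepsilon>0$ and a confidence level $1-\alpha$ with $\alpha\in(0,1)$, and define $$t_{\min,A}(\varepsilon,\alpha)=\frac{1}{2\varepsilon^2}\left(\sqrt{\tilde\sigma_A^2}+\sqrt{\tilde\sigma_A^2+2c_A\varepsilon}\right)^2\log\left(\frac{2N_\nu}{\alpha}\right).$$ Then $r_A(\alpha,t)\le\varepsilon$ if and only if $t\ge t_{\min,A}(\varepsilon,\alpha)$. In particular, for every $t\ge t_{\min,A}(\varepsilon,\alpha)$, $$\mathbb{P}^\nu\left(-\varepsilon\le\overline{A}_t-\mathbb{E}^\mu[\overline{A}_t]\le\varepsilon\right)\ge1-\alpha.$$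 Moreover, the minimal time admits the two-sided estimate $$\frac{2\tilde\sigma_A^2}{\varepsilon^2}\log\left(\frac{2N_\nu}{\alpha}\right)\le t_{\min,A}(\varepsilon,\alpha)\le\left(\frac{2\tilde\sigma_A^2}{\varepsilon^2}+\frac{2c_A}{\varepsilon}\right)\log\left(\frac{2N_\nu}{\alpha}\right),$$ and the corresponding one-sided guarantees at tolerance $\varepsilon$, $$\mathbb{P}^\nu\left(\overline{A}_t-\mathbb{E}^\mu[\overline{A}_t]\le\varepsilon\right)\ge1-\alpha,\qquad\mathbb{P}^\nu\left(\mathbb{E}^\mu[\overline{A}_t]-\overline{A}_t\le\varepsilon\right)\ge1-\alpha,$$ hold for all $t\ge t_{\min,A}^{(1)}(\varepsilon,\alpha)$, where $t^{(1)}_{\min,A}(\varepsilon,\alpha)$ is obtained from the formula for $t_{\min,A}(\varepsilon,\alpha)$ by replacing $2N_\nu$ with $N_\nu$.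
   Context: Setting. The state space is $\mathbb{R}^d$ (or a bounded subdomain; formulas are written for $\mathbb{R}^d$). $(X_t)_{t\ge0}$ is the strong solution of $dX_t=b(X_t)\,dt+\sigma\,dB_t$ with $b$ Lipschitz, $\sigma\in\mathbb{R}^{d\times m}$ constant with $\sigma\sigma^\top>0$, and $B$ a standard $m$-dimensional Wiener process; $D=\frac12\sigma\sigma^\top$. $\mathbb{P}^\nu$ is the law with $X_0\sim\nu$. The process is ergodic: $\mu$ is the unique invariant probability measure (any $f\in L^2(\mu)$ with $P_tf=f$ for all $t\ge0$ is $\mu$-a.e. constant), and it has a smooth, strictly positive density $p_{\mathrm s}$. The transition semigroup $(P_t)_{t\ge0}$ is strongly continuous on real $L^2(\mu)$ with generator $\mathcal{L}=b\cdot\nabla+\nabla\cdot D\nabla$; $\mathcal{L}$ and its $L^2(\mu)$-adjoint $\mathcal{L}^\dagger$ have a common core in $D(\mathcal{L})\cap D(\mathcal{L}^\dagger)$ containing the constants; the Dirichlet form $\mathcal{E}(f,f)=-\langle\frac12(\mathcal{L}+\mathcal{L}^\dagger)f,f\rangle_\mu=\int\nabla f\cdot D\nabla f\,d\mu$ is closable with closure $(\mathcal{E},D(\mathcal{E}))$, and the Poincaré inequality $\lambda_{\mathrm{gap}}\mathrm{Var}_\mu(f)\le\mathcal{E}(f,f)$ holds for all $f\in D(\mathcal{E})$, where $\mathrm{Var}_\mu(f)=\int(f-\int f\,d\mu)^2d\mu$ and $\lambda_{\mathrm{gap}}>0$ is the optimal constant. $\overline{\rho}_t(V)=\frac1t\int_0^tV(X_s)\,ds$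 with $V$ bounded measurable; $\overline{J}_t(U)=\frac1t\int_0^tU(X_s)\circ dX_s$ (Stratonovich) with $U$ an $\mathbb{R}^d$-valued, bounded, continuously differentiable vector field with bounded derivatives. $\mathbb{E}^\mu[\overline{A}_t]$ is the stationary ($X_0\sim\mu$) mean, which does not depend on $t$. If $c_A=0$, the expression $\frac{\tilde\sigma_A^2}{c_A^2}h(\frac{c_Aa}{\tilde\sigma_A^2})$ is read as its limit $a^2/(2\tilde\sigma_A^2)$.
   Formalization: Each one-sided guarantee is proved assuming the corresponding one-sided sub-gamma tail bound with prefactor N_ν and the same parameters, since it does not follow from the two-sided bound with 2N_ν alone. *)

(* Defs.v *)
From HB Require Import structures.
From mathcomp Require Import all_boot all_order all_algebra.
From mathcomp Require Import all_classical all_reals all_analysis.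

Set Implicit Arguments.
Unset Strict Implicit.
Unset Printing Implicit Defensive.

Import Order.TTheory GRing.Theory Num.Theory.
Import numFieldNormedType.Exports.

Local Open Scope classical_set_scope.
Local Open Scope ring_scope.

(* Matrices over R, hence the state space 'cV[R]_d, carry their Borel
   sigma-algebra. *)
HB.instance Definition _ (R : realType) (m n : nat) :=
  Measurable.copy 'M[R]_(m, n) (g_sigma_algebraType (@open 'M[R]_(m, n))).

Section calculus.
Context {R : realType} {d : nat}.
Implicit Types (f : 'cV[R]_d -> R) (x : 'cV[R]_d).

Definition partial (i : 'I_d) f : 'cV[R]_d -> R :=
  fun x => 'D_(delta_mx i 0 : 'cV[R]_d) f x.

Fixpoint Ck (k : nat) f : Prop :=
  continuous f /\
  (if k is k'.+1 then
     forall i : 'I_d, (forall x, derivable f x (delta_mx i 0 : 'cV[R]_d)) /\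
                      Ck k' (partial i f)
   else True).

Definition smooth f : Prop := forall k, Ck k f.

Definition test_function f : Prop :=
  smooth f /\ exists r : R, forall x, r <= `|x| -> f x = 0.

(* b . grad f + div (D grad f) *)
Definition diffusion_operator (b : 'cV[R]_d -> 'cV[R]_d) (D : 'M[R]_d) f :
    'cV[R]_d -> R := fun x =>
  \sum_(i < d) b x i 0 * partial i f x +
  \sum_(i < d) partial i (fun y => \sum_(j < d) D i j * partial j f y) x.

(* grad f . D grad f *)
Definition energy_density (D : 'M[R]_d) f : 'cV[R]_d -> R := fun x =>
  \sum_(i < d) \sum_(j < d) partial i f x * D i j * partial j f x.

(* The Lebesgue measure is the only Borel measure with these values. *)
Definition is_lebesgue (lam : {measure set 'cV[R]_d -> \bar R}) : Prop :=
  forall a c : 'cV[R]_d, (forall i, a i 0 <= c i 0) ->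
  lam [set x : 'cV[R]_d | forall i, a i 0 < x i 0 <= c i 0] =
  (\prod_(i < d) (c i 0 - a i 0))%:E.

End calculus.

Section L2.
Context {R : realType} {d : nat}.
Notation E := 'cV[R]_d.
Variable mu : probability E R.
Implicit Types (f g : E -> R) (T : R -> (E -> R) -> E -> R)
  (L K : (E -> R) -> (E -> R) -> Prop) (C : set (E -> R)).

Definition L2 f : Prop := f \in Lfun mu 2%:E.

Definition L2norm f : \bar R := 'N[mu]_2%:E[EFin \o f].

Definition L2dist f g : \bar R := L2norm (fun x => f x - g x).

Definition L2inner f g : R := \int[mu]_x (f x * g x).

Definition Var f : R := \int[mu]_x (f x - \int[mu]_y f y) ^+ 2.

Record L2_semigroup T : Prop := {
  semigroup_bounded : forall t, 0 <= t -> exists c : R, forall f, L2 f ->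
    L2 (T t f) /\ (L2norm (T t f) <= c%:E * L2norm f)%E ;
  semigroup_linear : forall t (a : R) f g, 0 <= t -> L2 f -> L2 g ->
    {ae mu, forall x, T t (fun y => a * f y + g y) x = a * T t f x + T t g x} ;
  semigroup0 : forall f, L2 f -> {ae mu, forall x, T 0 f x = f x} ;
  semigroupD : forall s t f, 0 <= s -> 0 <= t -> L2 f ->
    {ae mu, forall x, T (s + t) f x = T s (T t f) x} ;
  semigroup_strongly_continuous : forall f, L2 f ->
    L2dist (T t f) f @[t --> 0^'+] --> 0%E }.

(* Unbounded operators are given by their graphs (up to mu-null sets):
   [generator T f g] reads "f is in the domain and g is a version of L f". *)
Definition generator T f g : Prop :=
  [/\ L2 f, L2 g &
      L2dist (fun x => (T t f x - f x) / t) g @[t --> 0^'+] --> 0%E].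

Definition adjoint L f g : Prop :=
  [/\ L2 f, L2 g & forall u v, L u v -> L2inner v f = L2inner u g].

Definition linear_subspace C : Prop :=
  C (cst 0) /\ forall (a : R) f g, C f -> C g -> C (fun x => a * f x + g x).

Definition is_core C L : Prop :=
  (forall f, C f -> exists g, L f g) /\
  forall f g, L f g -> forall e : R, 0 < e -> exists u v,
    [/\ C u, L u v, (L2dist u f < e%:E)%E & (L2dist v g < e%:E)%E].

(* A version of L f, for f in the domain of L. *)
Definition image_of L f : E -> R := xget (cst 0) [set g | L f g].

(* - < (L + K)/2 f, f >, to be used with K the adjoint of L. *)
Definition dirichlet_form L K f : R :=
  - L2inner (fun x => (image_of L f x + image_of K f x) / 2) f.

Definition form_cauchy (Q : (E -> R) -> R) (u : nat -> E -> R) : Prop :=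
  forall e : R, 0 < e -> exists N, forall n k, (N <= n)%N -> (N <= k)%N ->
    Q (u n \- u k) < e.

Definition closable (Q : (E -> R) -> R) C : Prop :=
  forall u : nat -> E -> R, (forall n, C (u n)) ->
  L2norm (u n) @[n --> \oo] --> 0%E -> form_cauchy Q u ->
  Q (u n) @[n --> \oo] --> (0 : R).

(* [form_closure Q C f e]: f is in the domain of the closure of the quadratic
   form Q with domain C, and e is the value of the closure at f. *)
Definition form_closure (Q : (E -> R) -> R) C f (e : R) : Prop :=
  L2 f /\ exists u : nat -> E -> R,
    [/\ forall n, C (u n), L2dist (u n) f @[n --> \oo] --> 0%E,
        form_cauchy Q u & Q (u n) @[n --> \oo] --> e].

End L2.

Section processes.
Context {R : realType} {dO : measure_display} {Omega : measurableType dO}.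
Context {d m : nat}.
Variable Q : probability Omega R.

(* [normal_prob a s] has standard deviation s; the n * m increments below are
   mutually independent. *)
Record wiener_process (B : R -> Omega -> 'cV[R]_m) : Prop := {
  wiener_measurable : forall t, 0 <= t -> measurable_fun setT (B t) ;
  wiener_paths : {ae Q, forall w, B 0 w = 0 /\
    {within `[0, +oo[, continuous (fun t => B t w)}} ;
  wiener_increments : forall (n : nat) (tau : nat -> R)
      (F : 'I_n -> 'I_m -> set R),
    0 <= tau 0%N -> (forall k, (k < n)%N -> tau k < tau k.+1) ->
    (forall k i, measurable (F k i)) ->
    Q [set w | forall k i, F k i ((B (tau k.+1) w - B (tau k) w) i 0)] =
    (\prod_(k < n) \prod_(i < m)
       normal_prob 0 (Num.sqrt (tau k.+1 - tau k)) (F k i))%E }.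

Definition independent_of_path (xi : Omega -> 'cV[R]_d)
    (B : R -> Omega -> 'cV[R]_m) : Prop :=
  forall (n : nat) (tau : 'I_n -> R) (G : set 'cV[R]_d)
    (F : 'I_n -> set 'cV[R]_m),
  (forall k, 0 <= tau k) -> measurable G -> (forall k, measurable (F k)) ->
  Q [set w | G (xi w) /\ forall k, F k (B (tau k) w)] =
  (Q [set w | G (xi w)] * Q [set w | forall k, F k (B (tau k) w)])%E.

(* Since sigma is constant, dX = b(X) dt + sigma dB is a pathwise integral
   equation; for Lipschitz b its solution is a functional of X_0 and of the
   path of B, so the solutions below are strong ones. *)
Record sde_solution (b : 'cV[R]_d -> 'cV[R]_d) (sigma : 'M[R]_(d, m))
    (X : R -> Omega -> 'cV[R]_d) (B : R -> Omega -> 'cV[R]_m)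
    (nu : probability 'cV[R]_d R) : Prop := {
  sde_measurable : forall t, 0 <= t -> measurable_fun setT (X t) ;
  sde_wiener : wiener_process B ;
  sde_initial : forall G, measurable G -> Q (X 0 @^-1` G) = nu G ;
  sde_independent : independent_of_path (X 0) B ;
  sde_equation : {ae Q, forall w,
    {within `[0, +oo[, continuous (fun t => X t w)} /\
    forall t, 0 <= t -> forall i : 'I_d,
      X t w i 0 = X 0 w i 0 +
        (\int[lebesgue_measure]_(s in `[0, t]) (b (X s w) i 0)) +
        (sigma *m B t w) i 0} }.

Definition is_rho_bar (X : R -> Omega -> 'cV[R]_d) (V : 'cV[R]_d -> R)
    (A : R -> Omega -> R) : Prop :=
  forall t, 0 < t -> {ae Q, forall w,
    A t w = t^-1 * \int[lebesgue_measure]_(s in `[0, t]) V (X s w)}.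

Definition midpoint_sum (X : R -> Omega -> 'cV[R]_d)
    (U : 'cV[R]_d -> 'cV[R]_d) (n : nat) (tau : nat -> R) (w : Omega) : R :=
  \sum_(k < n) \sum_(i < d)
    (U (X (tau k) w) i 0 + U (X (tau k.+1) w) i 0) / 2 *
    (X (tau k.+1) w i 0 - X (tau k) w i 0).

(* Y is the integral of U(X) o dX over [0, t]: the limit in probability of the
   midpoint sums as the mesh of the partition of [0, t] goes to 0. *)
Definition is_stratonovich_integral (X : R -> Omega -> 'cV[R]_d)
    (U : 'cV[R]_d -> 'cV[R]_d) (t : R) (Y : Omega -> R) : Prop :=
  forall eta e : R, 0 < eta -> 0 < e -> exists2 delta : R, 0 < delta &
    forall (n : nat) (tau : nat -> R), tau 0%N = 0 -> tau n = t ->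
    (forall k, (k < n)%N -> 0 <= tau k.+1 - tau k < delta) ->
    (Q [set w | (eta <= `|midpoint_sum X U n tau w - Y w|)%R] <= e%:E)%E.

Definition is_J_bar (X : R -> Omega -> 'cV[R]_d) (U : 'cV[R]_d -> 'cV[R]_d)
    (A : R -> Omega -> R) : Prop :=
  forall t, 0 < t -> is_stratonovich_integral X U t (fun w => t * A t w).

End processes.

Definition bounded_measurable (R : realType) (d : nat) (V : 'cV[R]_d -> R) :
    Prop :=
  measurable_fun setT V /\ exists c : R, forall x, `|V x| <= c.

Definition bounded_C1_field (R : realType) (d : nat)
    (U : 'cV[R]_d -> 'cV[R]_d) : Prop :=
  forall i : 'I_d, Ck 1 (fun x => U x i 0) /\
    exists c : R, forall x, `|U x i 0| <= c /\
      forall j : 'I_d, `|partial j (fun y => U y i 0) x| <= c.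

Section ergodic_diffusion.
Context {R : realType} {dO : measure_display} {Omega : measurableType dO}.
Context {d m : nat}.
Notation E := 'cV[R]_d.
(* [Pr nu] is the law on Omega under which X_0 ~ nu. *)
Variables (X : R -> Omega -> E) (Pr : probability E R -> probability Omega R).

Definition transition (t : R) (f : E -> R) : E -> R :=
  fun x => \int[Pr (\d_x : probability E R)]_w f (X t w).

Definition invariant_law (mu : probability E R) : Prop :=
  forall t G, 0 <= t -> measurable G -> Pr mu (X t @^-1` G) = mu G.

Definition diffusion_matrix (sigma : 'M[R]_(d, m)) : 'M[R]_d :=
  2^-1 *: (sigma *m sigma^T).

Record ergodic_diffusion (b : E -> E) (sigma : 'M[R]_(d, m))
    (B : R -> Omega -> 'cV[R]_m) (mu : probability E R) (lgap : R) : Prop := {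
  drift_lipschitz : exists c : R, forall x y, `|b x - b y| <= c * `|x - y| ;
  noise_nondegenerate : forall v : E, v != 0 ->
    0 < (v^T *m (sigma *m sigma^T) *m v) 0 0 ;
  diffusion_solution : forall nu, sde_solution (Pr nu) b sigma X B nu ;
  law_invariant : invariant_law mu ;
  law_unique : forall mu', invariant_law mu' ->
    forall G, measurable G -> mu' G = mu G ;
  law_ergodic : forall f, L2 mu f ->
    (forall t, 0 <= t -> {ae mu, forall x, transition t f x = f x}) ->
    exists c : R, {ae mu, forall x, f x = c} ;
  law_density : exists (lam : {measure set E -> \bar R}) (p : E -> R),
    [/\ is_lebesgue lam, smooth p, forall x, 0 < p x &
        forall G, measurable G -> mu G = (\int[lam]_(x in G) (p x)%:E)%E] ;
  transition_semigroup : L2_semigroup mu transition ;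
  generator_formula : forall f, test_function f ->
    generator mu transition f (diffusion_operator b (diffusion_matrix sigma) f) ;
  poincare :
    let L := generator mu transition in
    let L' := adjoint mu L in
    let Q := dirichlet_form mu L L' in
    exists C : set (E -> R),
    [/\ [/\ linear_subspace C, forall a : R, C (cst a),
            is_core mu C L & is_core mu C L'],
        closable mu Q C,
        (forall f, test_function f -> exists e, form_closure mu Q C f e) /\
        (forall f e, smooth f -> form_closure mu Q C f e ->
           (e%:E = \int[mu]_x (energy_density (diffusion_matrix sigma) f x)%:E)%E),
        0 < lgap /\
        (forall f e, form_closure mu Q C f e -> lgap * Var mu f <= e) &
        forall l : R,
          (forall f e, form_closure mu Q C f e -> l * Var mu f <= e) ->
          l <= lgap] }.

(* A is rho-bar(V) or J-bar(U), a.s. under the stationary law and under the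
   law started from nu. *)
Definition time_averaged_observable (mu nu : probability E R)
    (A : R -> Omega -> R) : Prop :=
  (exists2 V, bounded_measurable V &
     is_rho_bar (Pr mu) X V A /\ is_rho_bar (Pr nu) X V A) \/
  (exists2 U, bounded_C1_field U &
     is_J_bar (Pr mu) X U A /\ is_J_bar (Pr nu) X U A).

End ergodic_diffusion.

Section concentration.
Context {R : realType}.

Definition density_norm (d : nat) (mu nu : probability 'cV[R]_d R) : \bar R :=
  'N[mu]_2%:E[Radon_Nikodym (charge_of_finite_measure nu) mu].

Definition subgamma_h (u : R) : R := 1 + u - Num.sqrt (1 + 2 * u).

(* s2 stands for sigma^2; for c = 0 the rate is the limit c -> 0. *)
Definition subgamma_rate (s2 c a : R) : R :=
  if c == 0 then a ^+ 2 / (2 * s2) else s2 / c ^+ 2 * subgamma_h (c * a / s2).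

(* K is the prefactor: 2 N_nu for the two-sided bound, N_nu for the one-sided
   bounds. *)
Definition conf_radius (s2 c K alpha t : R) : R :=
  Num.sqrt (2 * s2 / t * ln (K / alpha)) + c / t * ln (K / alpha).

Definition tmin (s2 c K eps alpha : R) : R :=
  (2 * eps ^+ 2)^-1 * (Num.sqrt s2 + Num.sqrt (s2 + 2 * c * eps)) ^+ 2 *
  ln (K / alpha).

End concentration.

(* Main.v *)
Require Import Defs.
From HB Require Import structures.
From mathcomp Require Import all_boot all_order all_algebra.
From mathcomp Require Import all_classical all_reals all_analysis.
From mathcomp Require Import measurable_realfun ring lra.

(** Write [L = ln (K / alpha)], where [K] is the prefactor of a sub-gamma tail
    bound, and let [q] be the sub-gamma rate at deviation [eps], so that the
    bound at time [t] reads [K * expR (- (t * q))].  It is at most [alpha]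
    exactly when [t * q >= L], so the natural minimal time is [L / q].
    Rationalizing [h (u) = 1 + u - sqrt (1 + 2 u)] gives
    [q = 2 eps^2 / (sqrt s2 + sqrt (s2 + 2 c eps))^2], a formula that also
    covers [c = 0]; hence [tmin = L / q] ([tmin_rate]).  The probabilistic
    guarantees follow by passing to the complement of the tail event
    ([tail_confidence]).

    The confidence radius inverts the same rate: in the variable
    [z = sqrt (2 L / t)] it is the increasing quadratic
    [sqrt s2 * z + c / 2 * z^2], which takes the value [eps] precisely at
    [z0 = 2 eps / (sqrt s2 + sqrt (s2 + 2 c eps))]; solving [z <= z0] for [t]
    gives [t >= tmin] ([conf_radius_le_tmin]).  The two-sided estimate of [tmin]
    is [(2 S)^2 <= (S + T)^2 <= 2 (S^2 + T^2)] for [S = sqrt s2] and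
    [T = sqrt (s2 + 2 c eps) >= S].

    All of this needs [L > 0], that is, [K > alpha] for [K = N_nu] and for
    [K = 2 N_nu].  This holds because [N_nu >= 1]: the density of [nu] has
    integral 1 with respect to the probability [mu], and on a probability space
    the L^1 norm is at most the L^2 norm ([density_norm_ge1]). *)

Import Order.TTheory GRing.Theory Num.Theory.
Import numFieldNormedType.Exports.

Local Open Scope classical_set_scope.
Local Open Scope ring_scope.

Set Implicit Arguments.
Unset Strict Implicit.

(** * The norm of a density *)

Lemma Lnorm1_le_Lnorm2 (d : measure_display) (T : measurableType d)
    (R : realType) (P : probability T R) (f : T -> R) :
  measurable_fun setT f ->
  ('N[P]_1[EFin \o f] <= 'N[P]_2%:E[EFin \o f])%E.
Proof.
move=> mf.
have half : (2^-1 + 2^-1 = 1 :> R) by lra.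
have two_gt0 : 0 < 2 :> R by [].
have := hoelder P mf (@measurable_cst _ _ T R setT 1) two_gt0 two_gt0 half.
have -> : f \* cst 1 = f by apply/funext => x /=; rewrite mulr1.
by rewrite Lnorm_cst1 [X in (X `^ _)%E]probability_setT poweR1r mule1.
Qed.

(** This makes the logarithms [ln (K / alpha)] below positive, for both
    prefactors [K]. *)
Lemma density_norm_ge1 (R : realType) (d : nat)
    (mu nu : probability 'cV[R]_d R) :
  nu `<< mu -> (1 <= density_norm mu nu)%E.
Proof.
move=> numu; rewrite /density_norm.
set f := Radon_Nikodym _ _.
have f_fin x : f x \is a fin_num by exact: Radon_Nikodym_fin_num.
have f_int : mu.-integrable setT f by exact: Radon_Nikodym_integrable.
have f_meas := measurable_int mu f_int.
have f1 : (\int[mu]_x f x = 1)%E.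
  by rewrite -Radon_Nikodym_integral//; exact: probability_setT.
have fE : EFin \o (fine \o f) = f by apply/funext => x /=; rewrite fineK.
have mf : measurable_fun setT (fine \o f).
  exact: measurableT_comp (fine_measurable measurableT) f_meas.
rewrite -[X in Lnorm _ _ X]fE; apply: le_trans (Lnorm1_le_Lnorm2 mu mf).
rewrite Lnorm1 fE -[leLHS]f1.
apply: le_trans (lee_abs _) _.
exact: le_abse_integral measurableT f_meas.
Qed.

(** * The sub-gamma rate and the minimal time *)

Section subgamma.
Context {R : realType} (s2 c eps : R).
Hypotheses (s2_gt0 : 0 < s2) (c_ge0 : 0 <= c) (eps_gt0 : 0 < eps).

Let S : R := Num.sqrt s2.
Let T : R := Num.sqrt (s2 + 2 * c * eps).

Let S_gt0 : 0 < S. Proof. by rewrite sqrtr_gt0. Qed.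

Let S2 : S ^+ 2 = s2. Proof. by rewrite sqr_sqrtr// ltW. Qed.

Let ceps_ge0 : 0 <= 2 * c * eps. Proof. by rewrite !mulr_ge0// ltW. Qed.

Let T2 : T ^+ 2 = s2 + 2 * c * eps.
Proof. by rewrite sqr_sqrtr// addr_ge0 // ltW. Qed.

Let S_le_T : S <= T.
Proof. by rewrite ler_wsqrtr// lerDl. Qed.

Let ST_gt0 : 0 < S + T.
Proof. by rewrite addr_gt0// (lt_le_trans S_gt0). Qed.

(** Multiplying [h] by its conjugate removes the division by [c ^+ 2], which is
    why a single closed form covers [c = 0] as well. *)
Lemma subgamma_rateE :
  subgamma_rate s2 c eps =
  2 * eps ^+ 2 / (Num.sqrt s2 + Num.sqrt (s2 + 2 * c * eps)) ^+ 2.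
Proof.
rewrite -/S -/T /subgamma_rate; have S_neq0 := lt0r_neq0 S_gt0.
case: eqVneq => [c0|c_neq0].
  have -> : T = S by rewrite /T c0 mulr0 mul0r addr0.
  by rewrite -S2; field; rewrite S_neq0 lt0r_neq0// addr_gt0.
have -> : subgamma_h (c * eps / s2) = (T - S) ^+ 2 / (2 * s2).
  rewrite /subgamma_h.
  have -> : 1 + 2 * (c * eps / s2) = (T / S) ^+ 2.
    by rewrite expr_div_n T2 S2; field; exact: lt0r_neq0.
  rewrite sqrtr_sqr ger0_norm ?divr_ge0 ?sqrtr_ge0//.
  have -> : c * eps = (T ^+ 2 - S ^+ 2) / 2 by rewrite T2 S2; field.
  by rewrite -S2; field.
have -> : (T - S) ^+ 2 = (2 * c * eps) ^+ 2 / (S + T) ^+ 2.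
  have -> : 2 * c * eps = (T - S) * (S + T).
    have -> : (T - S) * (S + T) = T ^+ 2 - S ^+ 2 by ring.
    by rewrite T2 S2; ring.
  by field; exact: lt0r_neq0.
by rewrite -S2; field; rewrite S_neq0 c_neq0 lt0r_neq0.
Qed.

Lemma subgamma_rate_gt0 : 0 < subgamma_rate s2 c eps.
Proof.
by rewrite subgamma_rateE divr_gt0 ?mulr_gt0 ?exprn_gt0.
Qed.

Lemma tmin_rate (K alpha : R) :
  tmin s2 c K eps alpha = ln (K / alpha) / subgamma_rate s2 c eps.
Proof.
rewrite subgamma_rateE /tmin -/S -/T.
by field; rewrite !lt0r_neq0.
Qed.

Lemma subgamma_tail_le (K alpha t : R) : 0 < K -> 0 < alpha ->
  tmin s2 c K eps alpha <= t ->
  K * expR (- (t * subgamma_rate s2 c eps)) <= alpha.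
Proof.
move=> K0 alpha0; rewrite tmin_rate ler_pdivrMr ?subgamma_rate_gt0// => Lt.
have: expR (- (t * subgamma_rate s2 c eps)) <= expR (- ln (K / alpha)).
  by rewrite ler_expR lerN2.
by rewrite [leRHS]expRN lnK ?posrE ?divr_gt0// invf_div ler_pdivlMr// mulrC.
Qed.

Lemma ln_ratio_gt0 (K alpha : R) : 0 < alpha < K -> 0 < ln (K / alpha).
Proof. by move=> /andP[a0 aK]; rewrite ln_gt0// ltr_pdivlMr// mul1r. Qed.

Lemma tmin_gt0 (K alpha : R) : 0 < alpha < K -> 0 < tmin s2 c K eps alpha.
Proof.
by move=> aK; rewrite tmin_rate divr_gt0 ?subgamma_rate_gt0// ln_ratio_gt0.
Qed.

Lemma conf_radius_le_tmin (K alpha t : R) : 0 < alpha < K -> 0 < t ->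
  (conf_radius s2 c K alpha t <= eps) = (tmin s2 c K eps alpha <= t).
Proof.
move=> aK t0; have L0 := ln_ratio_gt0 aK.
rewrite tmin_rate subgamma_rateE /conf_radius -/S -/T.
set L := ln _ in L0 *.
set z := Num.sqrt (2 * L / t).
have z2 : z ^+ 2 = 2 * L / t by rewrite sqr_sqrtr// ltW// divr_gt0// mulr_gt0.
have z0 : 0 <= z by exact: sqrtr_ge0.
have -> : Num.sqrt (2 * s2 / t * L) = S * z.
  by rewrite -sqrtrM 1?ltW//; congr Num.sqrt; field; exact: lt0r_neq0.
have -> : c / t * L = c / 2 * z ^+ 2.
  by rewrite z2; field; exact: lt0r_neq0.
pose w := 2 * eps / (S + T).
have w0 : 0 < w by rewrite divr_gt0// mulr_gt0.
(* This form of the positive root of the quadratic, unlike the one divided by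
   [c], is also valid for [c = 0]. *)
have root_w : S * w + c / 2 * w ^+ 2 = eps.
  have cE : c = (T - S) * (S + T) / (2 * eps).
    have -> : (T - S) * (S + T) = T ^+ 2 - S ^+ 2 by ring.
    by rewrite T2 S2; field; exact: lt0r_neq0.
  by rewrite cE /w; field; rewrite !lt0r_neq0.
have -> : (S * z + c / 2 * z ^+ 2 <= eps) = (z <= w).
  have fact : eps - (S * z + c / 2 * z ^+ 2) =
              (w - z) * (S + c / 2 * (w + z)).
    by rewrite -[in LHS]root_w; ring.
  rewrite -subr_ge0 fact pmulr_lge0 ?subr_ge0 ?ltr_wpDr// mulr_ge0 ?divr_ge0//.
  by rewrite addr_ge0// ltW.
rewrite -(ler_pXn2r (n := 2))// ?nnegrE// ?(ltW w0)// z2 /w.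
rewrite ler_pdivrMr// ler_pdivrMr ?divr_gt0 ?mulr_gt0 ?exprn_gt0//.
have -> : (2 * eps / (S + T)) ^+ 2 * t =
          2 * (t * (2 * eps ^+ 2 / (S + T) ^+ 2)).
  by field; exact: lt0r_neq0.
by rewrite ler_pM2l.
Qed.

Lemma tmin_bounds (K alpha : R) : 0 < alpha < K ->
  2 * s2 / eps ^+ 2 * ln (K / alpha) <= tmin s2 c K eps alpha <=
  (2 * s2 / eps ^+ 2 + 2 * c / eps) * ln (K / alpha).
Proof.
move=> /ln_ratio_gt0 L0.
have e2 : 0 < 2 * eps ^+ 2 by rewrite mulr_gt0 ?exprn_gt0.
have eps_neq0 := lt0r_neq0 eps_gt0.
rewrite /tmin -/S -/T !ler_pM2r// [_^-1 * _]mulrC.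
rewrite ler_pdivlMr// ler_pdivrMr//.
have -> : 2 * s2 / eps ^+ 2 * (2 * eps ^+ 2) = 4 * S ^+ 2.
  by rewrite S2; field.
have -> : (2 * s2 / eps ^+ 2 + 2 * c / eps) * (2 * eps ^+ 2) =
          2 * (S ^+ 2 + T ^+ 2).
  by rewrite S2 T2; field.
have S0 := S_gt0; have ST := S_le_T.
have TS0 := sqr_ge0 (T - S).
by apply/andP; split; nra.
Qed.

(** The two-sided guarantee is the case [Z = |dev|] with prefactor [2 N]; the
    one-sided ones are [Z = dev] and [Z = - dev] with prefactor [N]. *)
Lemma tail_confidence (d : measure_display) (Omega : measurableType d)
    (P : probability Omega R) (Z : R -> Omega -> R) (K alpha t : R) :
  (forall t, measurable_fun setT (Z t)) ->
  (forall t a : R, 0 < t -> 0 < a ->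
     (P [set w | (a <= Z t w)%R]
      <= (K * expR (- (t * subgamma_rate s2 c a)))%:E)%E) ->
  0 < alpha < K -> tmin s2 c K eps alpha <= t ->
  ((1 - alpha)%:E <= P [set w | (Z t w <= eps)%R])%E.
Proof.
move=> mZ tail aK tmin_t; have t0 := lt_le_trans (tmin_gt0 aK) tmin_t.
have /andP[a0 ltaK] := aK.
have mtail : measurable [set w | (eps <= Z t w)%R].
  rewrite -[X in measurable X]setTI.
  exact: measurable_fun_le (measurable_cst _) (mZ t).
have mgood : measurable [set w | (Z t w <= eps)%R].
  rewrite -[X in measurable X]setTI.
  exact: measurable_fun_le (mZ t) (measurable_cst _).
have Ptail : (P [set w | (eps <= Z t w)%R] <= alpha%:E)%E.
  apply: le_trans (tail t eps t0 eps_gt0) _.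
  by rewrite lee_fin subgamma_tail_le// (lt_trans a0).
apply: (@le_trans _ _ (P (~` [set w | (eps <= Z t w)%R]))).
  by rewrite probability_setC// EFinB leeB.
apply: le_measure; rewrite ?inE//; first exact: measurableC.
by move=> w /= /negP; rewrite -ltNge => /ltW.
Qed.

End subgamma.

Unset Implicit Arguments.
Set Strict Implicit.

(** * Confidence intervals for time averages *)

Theorem theorem6p2 (R : realType) (d m : nat)
  (dO : measure_display) (Omega : measurableType dO)
  (b : 'cV[R]_d -> 'cV[R]_d) (sigma : 'M[R]_(d, m))
  (X : R -> Omega -> 'cV[R]_d) (B : R -> Omega -> 'cV[R]_m)
  (Pr : probability 'cV[R]_d R -> probability Omega R)
  (mu nu : probability 'cV[R]_d R) (lgap : R)
  (hX : ergodic_diffusion X Pr b sigma B mu lgap)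
  (hnu : nu `<< mu) (hN : (density_norm mu nu < +oo)%E)
  (A : R -> {mfun Omega >-> R})
  (hA : time_averaged_observable X Pr mu nu (fun t => A t))
  (s2 c : R) (hs2 : 0 < s2) (hc : 0 <= c) :
  let N := fine (density_norm mu nu) in
  let dev := fun (t : R) (w : Omega) => A t w - fine ('E_(Pr mu)[A t])%E in
  (forall t a : R, 0 < t -> 0 < a ->
     (Pr nu [set w | (a <= `|dev t w|)%R]
      <= (2 * N * expR (- (t * subgamma_rate s2 c a)))%:E)%E) ->
  forall eps alpha : R, 0 < eps -> 0 < alpha < 1 ->
  let t2 := tmin s2 c (2 * N) eps alpha in
  let t1 := tmin s2 c N eps alpha in
  [/\ forall t : R, 0 < t ->
        (conf_radius s2 c (2 * N) alpha t <= eps <-> t2 <= t),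
      forall t : R, t2 <= t ->
        ((1 - alpha)%:E <= Pr nu [set w | (- eps <= dev t w <= eps)%R])%E,
      2 * s2 / eps ^+ 2 * ln (2 * N / alpha) <= t2
      /\ t2 <= (2 * s2 / eps ^+ 2 + 2 * c / eps) * ln (2 * N / alpha),
      (forall t a : R, 0 < t -> 0 < a ->
         (Pr nu [set w | (a <= dev t w)%R]
          <= (N * expR (- (t * subgamma_rate s2 c a)))%:E)%E) ->
      forall t : R, t1 <= t ->
        ((1 - alpha)%:E <= Pr nu [set w | (dev t w <= eps)%R])%E &
      (forall t a : R, 0 < t -> 0 < a ->
         (Pr nu [set w | (a <= - dev t w)%R]
          <= (N * expR (- (t * subgamma_rate s2 c a)))%:E)%E) ->
      forall t : R, t1 <= t ->
        ((1 - alpha)%:E <= Pr nu [set w | (- dev t w <= eps)%R])%E].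
Proof.
move=> N dev tail eps alpha eps0 alpha01 t2 t1.
have N1 : 1 <= N.
  have N1 := density_norm_ge1 hnu.
  by rewrite -lee_fin fineK// ge0_fin_numE// (le_trans _ N1).
have alphaN : 0 < alpha < N.
  by have /andP[-> /lt_le_trans ->] := alpha01.
have alpha2N : 0 < alpha < 2 * N by lra.
have mdev t : measurable_fun setT (dev t).
  by apply: measurable_funB => //; exact: measurable_cst.
split.
- by move=> t t0; rewrite (conf_radius_le_tmin hs2 hc eps0 alpha2N t0).
- move=> t t2t; under eq_set do rewrite -ler_norml.
  apply: (tail_confidence hs2 hc eps0
    (Z := fun s w => `|dev s w|) _ tail alpha2N t2t) => s.
  exact: measurableT_comp.
- by apply/andP; exact: tmin_bounds.
- by move=> tail1 t t1t; exact: (tail_confidence hs2 hc eps0 mdev tail1).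
- move=> tail1 t t1t.
  apply: (tail_confidence hs2 hc eps0
    (Z := fun s w => - dev s w) _ tail1 alphaN t1t) => s.
  exact: measurableT_comp.
Qed.
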